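(* Let $E$ be a monotonically bounded Banach lattice. Then a subset of $E$ is order-bounded if and only if it is multi-bounded with respect to the lattice multi-norm based on $E$.
   Context: A Banach lattice is here the complexification $E=E_{\mathbb R}\oplus iE_{\mathbb R}$ of a real Banach lattice $E_{\mathbb R}$, with modulus $|x+iy|=\bigvee\{x\cos\theta+y\sin\theta:0\le\theta\le2\pi\}$ and norm $\|z\|=\|\,|z|\,\|$; $E^+$ is the positive cone of $E_{\mathbb R}$. $E$ is monotonically bounded if every increasing net in $\{x\in E^+:\|x\|\le1\}$ is bounded above. A subset $S$ of $E$ is order-bounded if there exists $x\in E^+$ with $|z|\le x$ for all $z\in S$. The lattice multi-norm based on $E$ is $\|(x_1,\dots,x_n)\|_n^L=\|\,|x_1|\vee\cdots\vee|x_n|\,\|$. A subset $B$ of $E$ is multi-bounded with respect to it if $\sup\{\|(x_1,\dots,x_n)\|_n^L:x_1,\dots,x_n\in B,\ n\in\mathbb N\}<\infty$. *)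

(* Defs.v *)
From HB Require Import structures.
From mathcomp Require Import all_boot all_order all_algebra.
From mathcomp Require Import all_classical all_reals all_analysis.
From mathcomp Require Import complex.

Set Implicit Arguments.
Unset Strict Implicit.
Unset Printing Implicit Defensive.

Import Order.TTheory GRing.Theory Num.Theory.
Import numFieldNormedType.Exports.

Local Open Scope classical_set_scope.
Local Open Scope ring_scope.

(* Real Banach lattices. The order and the lattice operations are fields of the
   mixin rather than an instance of [Order.Lattice], because MathComp declares
   no joins between its normed modules and its lattices. The lattice absolute
   value is written [vjoin x (- x)], because [`|x|] is the norm of [x]. *)
HB.mixin Record isBanachLattice (R : realType) E & CompleteNormedModule R E := {
  vle : rel E;
  vjoin : E -> E -> E;
  vmeet : E -> E -> E;
  vle_refl : reflexive vle;
  vle_anti : antisymmetric vle;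
  vle_trans : transitive vle;
  vjoin_le : forall x y z, vle (vjoin x y) z = vle x z && vle y z;
  vle_meet : forall x y z, vle z (vmeet x y) = vle z x && vle z y;
  vle_add2r : forall z x y, vle x y -> vle (x + z) (y + z);
  vscale_ge0 : forall (a : R) x, 0 <= a -> vle 0 x -> vle 0 (a *: x);
  vnorm_mono : forall x y, vle (vjoin x (- x)) (vjoin y (- y)) -> `|x| <= `|y|
}.

#[short(type="banachLatticeType")]
HB.structure Definition BanachLattice (R : realType) :=
  {E of CompleteNormedModule R E & isBanachLattice R E}.

Notation "x <=v y" := (vle x y) (at level 70, no associativity) : ring_scope.

Section BanachLatticeDefs.
Context {R : realType} {E : banachLatticeType R}.

Definition is_lub (A : set E) (s : E) : Prop :=
  (forall x, A x -> x <=v s) /\ (forall u, (forall x, A x -> x <=v u) -> s <=v u).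

(* The complexification of [E] is carried by [complex E], i.e. by the formal
   sums [Complex x y] for [x + iy].
   The supremum below exists in every Banach lattice, so the default value [0]
   of [xget] is never used. *)
Definition modulus (z : complex E) : E :=
  xget 0 (is_lub [set cos t *: complex.Re z + sin t *: complex.Im z
                 | t in [set t : R | 0 <= t <= 2 * pi]]).

Definition order_bounded (S : set (complex E)) : Prop :=
  exists2 x : E, 0 <=v x & forall z, S z -> modulus z <=v x.

(* The multi-norm of an [n.+1]-tuple; the join is idempotent, so starting it at
   [modulus (x ord0)] does not change its value. *)
Definition lattice_multi_norm (n : nat) (x : 'I_n.+1 -> complex E) : R :=
  `| \big[vjoin/modulus (x ord0)]_(i < n.+1) modulus (x i) |.

End BanachLatticeDefs.

(* A net is indexed by a nonempty directed preordered set. *)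
Record directed_preorder (I : Type) (le : I -> I -> Prop) : Prop := {
  directed_inhabited : inhabited I;
  directed_refl : forall i, le i i;
  directed_trans : forall i j k, le i j -> le j k -> le i k;
  directed_ub : forall i j, exists k, le i k /\ le j k
}.

(* On the positive cone the norm of the complexification is that of [E]. *)
Definition monotonically_bounded (R : realType) (E : banachLatticeType R) :
    Prop :=
  forall (I : Type) (le : I -> I -> Prop) (x : I -> E),
    directed_preorder le ->
    (forall i j, le i j -> x i <=v x j) ->
    (forall i, 0 <=v x i /\ `|x i| <= 1) ->
    exists u : E, forall i, x i <=v u.

(* [N n] is the norm on [n.+1]-tuples. *)
Definition multi_bounded (R : realType) (T : Type)
    (N : forall n, ('I_n.+1 -> T) -> R) (B : set T) : Prop :=
  (ereal_sup [set r : \bar R | exists n (x : 'I_n.+1 -> T),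
                (forall i, B (x i)) /\ r = (N n x)%:E] < +oo)%E.

(* Main.v *)
Require Import Defs.
From mathcomp Require Import all_boot all_order all_algebra.
From mathcomp Require Import all_classical all_reals all_analysis.
From mathcomp Require Import complex.

(** The joins of the moduli of finite families in [B], ordered by the order of
    the lattice, form an increasing net because two families can be
    concatenated. If [B] is multi-bounded, a scalar multiple of this net lies in
    the unit ball, so monotone boundedness gives an upper bound, which bounds
    [B] because of the one-element families. Conversely, an upper bound of [B]
    dominates all these joins, and the norm is monotone on the positive cone. *)

Set Implicit Arguments.
Unset Strict Implicit.
Unset Printing Implicit Defensive.

Import Order.TTheory GRing.Theory Num.Theory.
Import numFieldNormedType.Exports.

Local Open Scope classical_set_scope.
Local Open Scope ring_scope.

#[local] Arguments vle_trans {R s y x z}.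

Section BanachLatticeTheory.
Context {R : realType} {E : banachLatticeType R}.
Implicit Types (x y z u : E) (a : R).

Lemma vleD x y z u : x <=v y -> z <=v u -> x + z <=v y + u.
Proof.
move=> xy zu; apply: (vle_trans (vle_add2r z _ _ xy)).
by rewrite ![y + _]addrC; exact: vle_add2r.
Qed.

Lemma vsubr_ge0 x y : (0 <=v y - x) = (x <=v y).
Proof.
apply/idP/idP => [/(vle_add2r x)|/(vle_add2r (- x))].
  by rewrite add0r subrK.
by rewrite subrr.
Qed.

Lemma vle_scale a x y : 0 <= a -> x <=v y -> a *: x <=v a *: y.
Proof.
by move=> a0; rewrite -vsubr_ge0 -[in X in _ -> X]vsubr_ge0 -scalerBr;
  exact: vscale_ge0.
Qed.

Lemma vjoin_ub x y : (x <=v vjoin x y) /\ (y <=v vjoin x y).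
Proof. by apply/andP; rewrite -vjoin_le vle_refl. Qed.

(** Both [x] and [- x] lie below [y], since [- x <=v 0 <=v x <=v y], so their join lies below the
    lattice absolute value of [y]. *)
Lemma ler_vnorm x y : 0 <=v x -> x <=v y -> `|x| <= `|y|.
Proof.
move=> x0 xy; apply: vnorm_mono; have [yj _] := vjoin_ub y (- y).
rewrite vjoin_le (vle_trans xy yj) /=; apply: (@vle_trans _ _ 0).
  by rewrite -vsubr_ge0 sub0r opprK.
exact: vle_trans x0 (vle_trans xy yj).
Qed.

(* If the supremum exists, it lies above [Re z] and [- Re z] (take [t = 0] and
   [t = pi]); otherwise [xget] returns [0]. *)
Lemma modulus_ge0 (z : complex E) : 0 <=v modulus z.
Proof.
rewrite /modulus; case: xgetP => [s _ [ub _]|_]; last exact: vle_refl.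
have hp : complex.Re z <=v s.
  apply: ub; exists 0; last by rewrite cos0 sin0 scale1r scale0r addr0.
  by rewrite /= lexx mulr_ge0 ?pi_ge0.
have hm : - complex.Re z <=v s.
  apply: ub; exists pi; last by rewrite cospi sinpi scaleN1r scale0r addr0.
  by rewrite /= pi_ge0 ler_peMl ?pi_ge0 ?ler1n.
(* Adding the two bounds gives [0 <=v s + s]; scaling by one half gives [0 <=v s]. *)
have := vscale_ge0 (2^-1 : R) (s + s).
rewrite -mulr2n -[s *+ 2]scaler_nat scalerA mulVf ?pnatr_eq0 // scale1r.
apply; first by rewrite invr_ge0.
by rewrite scaler_nat mulr2n -(subrr (complex.Re z)); exact: vleD.
Qed.

Lemma bigvjoin_le (I : Type) (r : seq I) (F : I -> E) x u :
  (\big[vjoin/x]_(i <- r) F i <=v u) = (x <=v u) && all (fun i => F i <=v u) r.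
Proof.
elim: r => [|i r IHr]; first by rewrite big_nil andbT.
by rewrite big_cons vjoin_le IHr /= andbCA.
Qed.

(** The vector whose norm is, by unfolding, [lattice_multi_norm x]. *)
Definition join_modulus (n : nat) (x : 'I_n.+1 -> complex E) : E :=
  \big[vjoin/modulus (x ord0)]_(i < n.+1) modulus (x i).

(** The starting value [modulus (x ord0)] belongs to the family, so it adds no condition. *)
Lemma join_modulus_leP n (x : 'I_n.+1 -> complex E) u :
  join_modulus x <=v u <-> forall i, modulus (x i) <=v u.
Proof.
rewrite /join_modulus bigvjoin_le; split=> [/andP[_ /allP h] i|h].
  by apply: h; rewrite mem_index_enum.
by rewrite h; apply/allP.
Qed.

Lemma modulus_le_join n (x : 'I_n.+1 -> complex E) i :
  modulus (x i) <=v join_modulus x.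
Proof. by move: i; apply/join_modulus_leP; exact: vle_refl. Qed.

Lemma join_modulus_ge0 n (x : 'I_n.+1 -> complex E) : 0 <=v join_modulus x.
Proof. exact: vle_trans (modulus_ge0 _) (modulus_le_join x ord0). Qed.

Definition family_in (B : set (complex E)) : Type :=
  {n : nat & {x : 'I_n.+1 -> complex E | forall i, B (x i)}}.

Definition join_family (B : set (complex E)) (s : family_in B) : E :=
  join_modulus (sval (projT2 s)).

Lemma directed_join_family (B : set (complex E)) :
  B !=set0 ->
  directed_preorder (fun s t : family_in B => join_family s <=v join_family t).
Proof.
move=> [b Bb]; split.
- by constructor; exists 0%N; exists (fun=> b).
- by move=> s; exact: vle_refl.
- by move=> s t w; exact: vle_trans.
- move=> [n [x Bx]] [m [y By]].
  (* The length [(n + m.+1).+1] is convertible to [n.+1 + m.+1], so an index splits into one of [x]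
     or one of [y]. *)
  pose z (i : 'I_(n + m.+1).+1) : complex E :=
    match @fintype.split n.+1 m.+1 i with inl i => x i | inr j => y j end.
  have Bz i : B (z i) by rewrite /z; case: fintype.split.
  exists (existT _ (n + m.+1)%N (exist _ z Bz)).
  split; apply/join_modulus_leP => i /=.
  + have -> : x i = z (@lshift n.+1 m.+1 i).
      by rewrite /z -[lshift _ _]/(unsplit (inl i)) unsplitK.
    exact: modulus_le_join.
  + have -> : y i = z (@rshift n.+1 m.+1 i).
      by rewrite /z -[rshift _ _]/(unsplit (inr i)) unsplitK.
    exact: modulus_le_join.
Qed.

End BanachLatticeTheory.

Lemma multi_boundedP (R : realType) (T : Type)
    (N : forall n, ('I_n.+1 -> T) -> R) (B : set T) :
  multi_bounded N B <->
  exists r : R, forall n (x : 'I_n.+1 -> T), (forall i, B (x i)) -> N n x <= r.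
Proof.
rewrite /multi_bounded; set A := [set r | _]; split=> [|[r rN]].
  have ubA n (x : 'I_n.+1 -> T) :
      (forall i, B (x i)) -> ((N n x)%:E <= ereal_sup A)%E.
    by move=> Bx; apply: ereal_sup_ubound; exists n, x.
  case: (ereal_sup A) ubA => [r ubA _|//|ubA _].
    by exists r => n x /ubA; rewrite lee_fin.
  (* If the supremum is minus infinity, there is no tuple in [B] and any bound will do. *)
  by exists 0 => n x /ubA; rewrite leeNy_eq.
apply: (@le_lt_trans _ _ r%:E); last exact: ltry.
by apply: ge_ereal_sup => _ [n [x [Bx ->]]]; rewrite lee_fin; exact: rN.
Qed.

Theorem theorem6p8 (R : realType) (E : banachLatticeType R)
    (hE : monotonically_bounded E) (B : set (complex E)) :
  order_bounded B <-> multi_bounded (@lattice_multi_norm R E) B.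
Proof.
split=> [[u u0 Bu]|/multi_boundedP[r rN]].
  apply/multi_boundedP; exists `|u| => n x Bx.
  apply: ler_vnorm; first exact: join_modulus_ge0.
  by apply/join_modulus_leP => i; exact: Bu.
(* The empty set has no families to index a net, so it is treated apart. *)
have [->|B0] := eqVneq B set0; first by exists 0 => //; exact: vle_refl.
(* This [c] is positive whatever the sign of [r], and [r <= c], so dividing the joins by [c] brings
   them into the unit ball. *)
move/set0P: B0 => B0; pose c : R := `|r| + 1.
have c0 : 0 < c by rewrite ltr_wpDl.
have ci0 : 0 <= c^-1 by rewrite invr_ge0 ltW.
have [||u ubu] :=
  hE _ _ (fun s => c^-1 *: join_family s) (directed_join_family B0).
- by move=> s t; exact: vle_scale.
- move=> [n [x Bx]]; split.
    by apply: vscale_ge0 => //; exact: join_modulus_ge0.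
  rewrite normrZ ger0_norm // mulrC ler_pdivrMr // mul1r.
  by rewrite (le_trans (rN n x Bx)) // (le_trans (ler_norm r)) // lerDl.
have Bcu z : B z -> modulus z <=v c *: u.
  move=> Bz; pose x (_ : 'I_1) := z.
  have Bx i : B (x i) by [].
  have := ubu (existT _ 0%N (exist _ x Bx)).
  move/(vle_scale (ltW c0)); rewrite scalerA mulfV ?gt_eqF // scale1r.
  exact: vle_trans (modulus_le_join x ord0).
(* Positivity of [c *: u] comes from the modulus of a member of [B], which lies between [0] and
   [c *: u]. *)
exists (c *: u) => //; have [b Bb] := B0.
exact: vle_trans (modulus_ge0 b) (Bcu b Bb).
Qed.
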